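(* Let $n\ge 1$ be an integer, and let $\mathcal A,\mathcal B,\mathcal C$ be three extriangulated categories with enough projectives and enough injectives. Assume that $\mathcal B$ admits a recollement $(\mathcal A,\mathcal B,\mathcal C)$ relative to $\mathcal A$ and $\mathcal C$, with functors $i^{*},i^{!}:\mathcal B\to\mathcal A$, $i_{*}:\mathcal A\to\mathcal B$, $j^{*}:\mathcal B\to\mathcal C$, $j_{!},j_{*}:\mathcal C\to\mathcal B$. Assume that $(\mathcal T,\mathcal F)$ is an $n$-cotorsion pair in $\mathcal B$. If $i^{*}$ and $i^{!}$ are exact, $j_{*}j^{*}\mathcal F\subseteq\mathcal F$, $i_{*}i^{*}\mathcal T\subseteq\mathcal T$ and $i_{*}i^{*}\mathcal F\subseteq\mathcal F$, then: (1) $(i^{*}\mathcal T,i^{!}\mathcal F)$ is an $n$-cotorsion pair in $\mathcal A$; (2) $(j^{*}\mathcal T,j^{*}\mathcal F)$ is an $n$-cotorsion pair in $\mathcal C$; (3) if $(\mathcal T,\mathcal F)$ is a hereditary $n$-cotorsion pair in $\mathcal B$, then $(i^{*}\mathcal T,i^{!}\mathcal F)$ and $(j^{*}\mathcal T,j^{*}\mathcal F)$ are hereditary $n$-cotorsion pairs in $\mathcal A$ and $\mathcal C$, respectively.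
   Context: **Extriangulated categories.** These are taken in the sense of Nakaoka–Palu: a triplet $(\mathcal C,\mathbb E,\mathfrak s)$ with $\mathcal C$ additive, $\mathbb E:\mathcal C^{\rm op}\times\mathcal C\to\mathrm{Ab}$ an additive bifunctor, and $\mathfrak s$ an additive realization assigning to each $\delta\in\mathbb E(C,A)$ an equivalence class $[A\to B\to C]$, satisfying (ET3), (ET3)$^{\rm op}$, (ET4), (ET4)$^{\rm op}$. If $\mathfrak s(\delta)=[A\xrightarrow{x}B\xrightarrow{y}C]$, then $A\xrightarrow{x}B\xrightarrow{y}C\overset{\delta}{\dashrightarrow}$ is an $\mathbb E$-triangle, $x$ is an inflation and $y$ a deflation. All extriangulated categories are assumed to satisfy condition (WIC): if $gf$ is an inflation then so is $f$; if $gf$ is a deflation then so is $g$. An object $P$ is projective if every morphism $P\to C$ factors through $y$ for each $\mathbb E$-triangle $A\to B\xrightarrow{y}C\dashrightarrow$; injective objects are dual. $\mathcal C$ has enough projectives if each $C$ admits an $\mathbb E$-triangle $A\to P\to C\dashrightarrow$ with $P$ projective; enough injectives is dual. With enough projectives and injectives, for $\mathbb E$-triangles $\Omega A\to P\to A\dashrightarrow$ ($P$ projective) and $B\to I\to\Sigma B\dashrightarrow$ ($I$ injective), iterated, the higher extension groups are $\mathbb E^{k+1}(A,B):=\mathbb E(A,\Sigma^kB)\cong\mathbb E(\Omega^kA,B)$ for $k\ge0$. **Exactness notions.** A morphism $f$ is *compatible* if ''$f$ is both an inflation and a deflation'' implies that $f$ is an isomorphism. A sequence $A\xrightarrow{f}B\xrightarrow{g}C$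 is right exact if there are an $\mathbb E$-triangle $K\xrightarrow{h_2}B\xrightarrow{g}C\dashrightarrow$ and a compatible deflation $h_1:A\to K$ with $f=h_2h_1$; it is left exact if there are an $\mathbb E$-triangle $A\xrightarrow{f}B\xrightarrow{h_1}K\dashrightarrow$ and a compatible inflation $h_2:K\to C$ with $g=h_2h_1$. A four-term sequence $A\xrightarrow{f}B\xrightarrow{g}C\xrightarrow{h}D$ is a right exact (resp. left exact) $\mathbb E$-triangle sequence if there are $\mathbb E$-triangles $A\xrightarrow{f}B\xrightarrow{g_1}K\dashrightarrow$ and $K\xrightarrow{g_2}C\xrightarrow{h}D\dashrightarrow$ with $g=g_2g_1$ and $g_1$ (resp. $g_2$) compatible. An additive functor is right (resp. left) exact if it preserves compatible morphisms and right (resp. left) exact sequences. An additive functor $F:\mathcal A\to\mathcal B$ is exact if it preserves compatible morphisms and there is a natural transformation $\eta:\mathbb E_{\mathcal A}(-,-)\Rightarrow\mathbb E_{\mathcal B}(F-,F-)$ such that $\mathfrak s_{\mathcal A}(\delta)=[A\xrightarrow{x}B\xrightarrow{y}C]$ implies $\mathfrak s_{\mathcal B}(\eta(\delta))=[FA\xrightarrow{Fx}FB\xrightarrow{Fy}FC]$. **Recollement.** A recollement $(\mathcal A,\mathcal B,\mathcal C)$ of extriangulated categories consists of exact functors $i_*:\mathcal A\to\mathcal B$, $j^*:\mathcal B\to\mathcal C$, right exact functors $i^*:\mathcal B\to\mathcal A$, $j_!:\mathcal C\to\mathcal B$, and left exact functors $i^!:\mathcal B\to\mathcal A$, $j_*:\mathcal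 C\to\mathcal B$ such that: (R1) $(i^*,i_*,i^!)$ and $(j_!,j^*,j_* )$ are adjoint triples; (R2) $\operatorname{Im}i_*=\operatorname{Ker}j^*$; (R3) $i_*,j_!,j_*$ are fully faithful; (R4) for each $X\in\mathcal B$ there is a left exact $\mathbb E_{\mathcal B}$-triangle sequence $i_*i^!X\to X\to j_*j^*X\to i_*A$ with $A\in\mathcal A$, the first two maps being adjunction morphisms; (R5) for each $X\in\mathcal B$ there is a right exact $\mathbb E_{\mathcal B}$-triangle sequence $i_*A'\to j_!j^*X\to X\to i_*i^*X$ with $A'\in\mathcal A$, the last two maps being adjunction morphisms. **Resolution dimension.** For a class $\mathcal X$ of objects of $\mathcal C$ and $m\ge0$, an $\mathcal X$-resolution of $C$ of length $m$ is a complex $X_m\to\cdots\to X_0\to C$ with all $X_k\in\mathcal X$, obtained by splicing $\mathbb E$-triangles $K_{k+1}\to X_k\to K_k\dashrightarrow$ ($0\le k\le m-1$), where $K_0=C$ and $K_m=X_m$. $\mathcal X^{\wedge}_m$ is the class of objects having an $\mathcal X$-resolution of length at most $m$; $\mathcal X^{\vee}_m$ is defined dually with $\mathcal X$-coresolutions $C\to X_0\to\cdots\to X_m$. Thus $\mathcal X^\wedge_0=\mathcal X^\vee_0=\mathcal X$. **$n$-cotorsion pairs.** Let $\mathcal C$ have enough projectives and injectives. A pair $(\mathcal X,\mathcal Y)$ of classes of objects is a left $n$-cotorsion pair if: (1) $\mathcal X$ is closed under direct summands; (2) $\mathbb E^k(\mathcal X,\mathcal Y)=0$ for $1\le k\le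 n$; (3) every $C\in\mathcal C$ admits an $\mathbb E$-triangle $K\to X\to C\dashrightarrow$ with $X\in\mathcal X$, $K\in\mathcal Y^{\wedge}_{n-1}$. Dually it is a right $n$-cotorsion pair if $\mathcal Y$ is closed under direct summands, (2) holds, and every $C$ admits an $\mathbb E$-triangle $C\to Y\to K\dashrightarrow$ with $Y\in\mathcal Y$, $K\in\mathcal X^{\vee}_{n-1}$. It is an $n$-cotorsion pair if it is both. A (left or right) $n$-cotorsion pair is hereditary if $\mathbb E^{n+1}(\mathcal X,\mathcal Y)=0$. All classes of objects are closed under isomorphism; for a functor $F$ and a class $\mathcal X$, $F\mathcal X$ denotes the class of objects isomorphic to $FX$ for some $X\in\mathcal X$. *)

(* Defs.v *)
From mathcomp Require Import all_boot all_algebra.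
From mathcomp Require Import boolp classical_sets.

Set Implicit Arguments.
Unset Strict Implicit.
Unset Printing Implicit Defensive.
Import GRing.Theory.
Local Open Scope classical_set_scope.
Local Open Scope ring_scope.

Record preaddCat := PreaddCat {
  ob :> Type;
  hom : ob -> ob -> zmodType;
  idm : forall A : ob, hom A A;
  comp : forall A B C : ob, hom B C -> hom A B -> hom A C;
  comp_idl : forall (A B : ob) (f : hom A B), comp (idm B) f = f;
  comp_idr : forall (A B : ob) (f : hom A B), comp f (idm A) = f;
  comp_assoc : forall (A B C D : ob) (h : hom C D) (g : hom B C) (f : hom A B),
    comp h (comp g f) = comp (comp h g) f;
  comp_addl : forall (A B C : ob) (g g' : hom B C) (f : hom A B),
    comp (g + g') f = comp g f + comp g' f;
  comp_addr : forall (A B C : ob) (g : hom B C) (f f' : hom A B),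
    comp g (f + f') = comp g f + comp g f'
}.
Arguments idm {p} A.
Arguments comp {p A B C} g f.
Notation "g ∘ f" := (comp g f) (at level 40, left associativity).

Section CategoryNotions.
Variable C : preaddCat.
Implicit Types A B Z : C.

Definition is_iso A B (f : hom A B) : Prop :=
  exists g : hom B A, g ∘ f = idm A /\ f ∘ g = idm B.

Definition isomorphic A B : Prop := exists f : hom A B, is_iso f.

Definition is_zero Z : Prop :=
  (forall A (f : hom Z A), f = 0) /\ (forall A (f : hom A Z), f = 0).

Record biprod A B := Biprod {
  biprod_ob :> C;
  in1 : hom A biprod_ob;
  in2 : hom B biprod_ob;
  pr1 : hom biprod_ob A;
  pr2 : hom biprod_ob B;
  pr1_in1 : pr1 ∘ in1 = idm A;
  pr2_in2 : pr2 ∘ in2 = idm B;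
  pr1_in2 : pr1 ∘ in2 = 0;
  pr2_in1 : pr2 ∘ in1 = 0;
  biprod_id : in1 ∘ pr1 + in2 ∘ pr2 = idm biprod_ob
}.

Definition iso_closed (P : set C) : Prop :=
  forall A B, isomorphic A B -> P A -> P B.

Definition summand_closed (P : set C) : Prop :=
  forall A B (S : biprod A B), P S -> P A.

End CategoryNotions.
Arguments in1 {C A B} b.
Arguments in2 {C A B} b.
Arguments pr1 {C A B} b.
Arguments pr2 {C A B} b.

Definition biprod_map (C : preaddCat) (A A' B B' : C) (S : biprod A A')
    (T : biprod B B') (f : hom A B) (f' : hom A' B') : hom S T :=
  in1 T ∘ f ∘ pr1 S + in2 T ∘ f' ∘ pr2 S.

Record addCat := AddCat {
  preadd :> preaddCat;
  has_zero : exists Z : preadd, is_zero Z;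
  has_biprod : forall A B : preadd, inhabited (biprod A B)
}.

(* [ext C A] is the group E(C, A), contravariant in [C]; [pull c] is c^* and
   [push a] is a_*.  The relation [realizes d x y] means s(d) = [A -x-> B -y-> C]:
   [real_ex] and [real_class] say that the sequences related to a given [d] form
   exactly one equivalence class. *)
Record extCat := ExtCat {
  addc :> addCat;
  ext : addc -> addc -> zmodType;
  pull : forall A C C' : addc, hom C' C -> ext C A -> ext C' A;
  push : forall A A' C : addc, hom A A' -> ext C A -> ext C A';
  pull_id : forall (A C : addc) (d : ext C A), pull (idm C) d = d;
  push_id : forall (A C : addc) (d : ext C A), push (idm A) d = d;
  pull_comp : forall (A C C' C'' : addc) (c : hom C' C) (c' : hom C'' C')
    (d : ext C A), pull (c ∘ c') d = pull c' (pull c d);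
  push_comp : forall (A A' A'' C : addc) (a' : hom A' A'') (a : hom A A')
    (d : ext C A), push (a' ∘ a) d = push a' (push a d);
  push_pull : forall (A A' C C' : addc) (a : hom A A') (c : hom C' C)
    (d : ext C A), push a (pull c d) = pull c (push a d);
  pull_add : forall (A C C' : addc) (c : hom C' C) (d d' : ext C A),
    pull c (d + d') = pull c d + pull c d';
  push_add : forall (A A' C : addc) (a : hom A A') (d d' : ext C A),
    push a (d + d') = push a d + push a d';
  pull_addm : forall (A C C' : addc) (c c' : hom C' C) (d : ext C A),
    pull (c + c') d = pull c d + pull c' d;
  push_addm : forall (A A' C : addc) (a a' : hom A A') (d : ext C A),
    push (a + a') d = push a d + push a' d;
  realizes : forall A B C : addc, ext C A -> hom A B -> hom B C -> Prop;
  real_ex : forall (A C : addc) (d : ext C A),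
    exists (B : addc) (x : hom A B) (y : hom B C), realizes d x y;
  real_class : forall (A B B' C : addc) (d : ext C A) (x : hom A B)
    (y : hom B C) (x' : hom A B') (y' : hom B' C),
    realizes d x y ->
    (realizes d x' y' <->
     exists b : hom B B', is_iso b /\ b ∘ x = x' /\ y' ∘ b = y)
}.
Arguments ext {e} C A.
Arguments pull {e A C C'} c d.
Arguments push {e A A' C} a d.
Arguments realizes {e A B C} d x y.

Definition ext_sum (K : extCat) (A A' C C' : K) (SA : biprod A A')
    (SC : biprod C C') (d : ext C A) (d' : ext C' A') :
    ext (SC : K) (SA : K) :=
  push (in1 SA) (pull (pr1 SC) d) + push (in2 SA) (pull (pr2 SC) d').

Record extriCat := ExtriCat {
  extc :> extCat;
  real_mor : forall (A B C A' B' C' : extc) (d : ext C A) (d' : ext C' A')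
    (x : hom A B) (y : hom B C) (x' : hom A' B') (y' : hom B' C')
    (a : hom A A') (c : hom C C'),
    realizes d x y -> realizes d' x' y' -> push a d = pull c d' ->
    exists b : hom B B', b ∘ x = x' ∘ a /\ y' ∘ b = c ∘ y;
  real_zero : forall (A C : extc) (S : biprod A C),
    realizes (0 : ext C A) (in1 S) (pr2 S);
  real_sum : forall (A B C A' B' C' : extc) (d : ext C A) (d' : ext C' A')
    (x : hom A B) (y : hom B C) (x' : hom A' B') (y' : hom B' C')
    (SA : biprod A A') (SB : biprod B B') (SC : biprod C C'),
    realizes d x y -> realizes d' x' y' ->
    realizes (ext_sum SA SC d d')
      (biprod_map SA SB x x') (biprod_map SB SC y y');
  ET3 : forall (A B C A' B' C' : extc) (d : ext C A) (d' : ext C' A')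
    (x : hom A B) (y : hom B C) (x' : hom A' B') (y' : hom B' C')
    (a : hom A A') (b : hom B B'),
    realizes d x y -> realizes d' x' y' -> b ∘ x = x' ∘ a ->
    exists c : hom C C', push a d = pull c d' /\ y' ∘ b = c ∘ y;
  ET3op : forall (A B C A' B' C' : extc) (d : ext C A) (d' : ext C' A')
    (x : hom A B) (y : hom B C) (x' : hom A' B') (y' : hom B' C')
    (b : hom B B') (c : hom C C'),
    realizes d x y -> realizes d' x' y' -> y' ∘ b = c ∘ y ->
    exists a : hom A A', push a d = pull c d' /\ b ∘ x = x' ∘ a;
  ET4 : forall (A B C D F : extc) (d : ext D A) (d' : ext F B)
    (f : hom A B) (f' : hom B D) (g : hom B C) (g' : hom C F),
    realizes d f f' -> realizes d' g g' ->
    exists (E : extc) (h' : hom C E) (u : hom D E) (e : hom E F)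
      (d'' : ext E A),
      [/\ realizes d'' (g ∘ f) h',
          h' ∘ g = u ∘ f' /\ e ∘ h' = g',
          realizes (push f' d') u e,
          pull u d'' = d
        & push f d'' = pull e d'];
  ET4op : forall (A B C D F : extc) (d : ext B D) (d' : ext C F)
    (f' : hom D A) (f : hom A B) (g' : hom F B) (g : hom B C),
    realizes d f' f -> realizes d' g' g ->
    exists (E : extc) (h' : hom E A) (u : hom D E) (e : hom E F)
      (d'' : ext C E),
      [/\ realizes d'' h' (g ∘ f),
          h' ∘ u = f' /\ f ∘ h' = g' ∘ e,
          realizes (pull g' d) u e,
          push e d'' = d'
        & push u d = pull g d'']
}.

Section ExtriangulatedNotions.
Variable K : extriCat.
Implicit Types A B C D P I M : K.

(* A -x-> B -y-> C underlies an E-triangle *)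
Definition Etriangle A B C (x : hom A B) (y : hom B C) : Prop :=
  exists d : ext C A, realizes d x y.

Definition inflation A B (x : hom A B) : Prop :=
  exists C (y : hom B C), Etriangle x y.

Definition deflation B C (y : hom B C) : Prop :=
  exists A (x : hom A B), Etriangle x y.

Definition WIC : Prop :=
  (forall A B C (f : hom A B) (g : hom B C), inflation (g ∘ f) -> inflation f)
  /\
  (forall A B C (f : hom A B) (g : hom B C), deflation (g ∘ f) -> deflation g).

Definition projective_ob P : Prop :=
  forall A B C (x : hom A B) (y : hom B C), Etriangle x y ->
  forall p : hom P C, exists q : hom P B, y ∘ q = p.

Definition injective_ob I : Prop :=
  forall A B C (x : hom A B) (y : hom B C), Etriangle x y ->
  forall p : hom A I, exists q : hom B I, q ∘ x = p.

Definition is_syzygy C A : Prop :=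
  exists P (x : hom A P) (y : hom P C), projective_ob P /\ Etriangle x y.

Definition is_cosyzygy A C : Prop :=
  exists I (x : hom A I) (y : hom I C), injective_ob I /\ Etriangle x y.

Definition enough_projectives : Prop := forall C, exists A, is_syzygy C A.

Definition enough_injectives : Prop := forall A, exists C, is_cosyzygy A C.

(* Sigma A, for a chosen E-triangle A -> I -> Sigma A with I injective. *)
Definition cosyzygy (enI : enough_injectives) A : K := projT1 (cid (enI A)).

(* E^{k+1}(A, B) := E(A, Sigma^k B) *)
Definition extS (enI : enough_injectives) (k : nat) A B : zmodType :=
  ext A (iter k (cosyzygy enI) B).

Definition compatible A B (f : hom A B) : Prop :=
  inflation f -> deflation f -> is_iso f.

Definition right_exact_seq A B C (f : hom A B) (g : hom B C) : Prop :=
  exists M (h2 : hom M B) (h1 : hom A M),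
    [/\ Etriangle h2 g, deflation h1, compatible h1 & f = h2 ∘ h1].

Definition left_exact_seq A B C (f : hom A B) (g : hom B C) : Prop :=
  exists M (h1 : hom B M) (h2 : hom M C),
    [/\ Etriangle f h1, inflation h2, compatible h2 & g = h2 ∘ h1].

Definition right_exact_triangle_seq A B C D
    (f : hom A B) (g : hom B C) (h : hom C D) : Prop :=
  exists M (g1 : hom B M) (g2 : hom M C),
    [/\ Etriangle f g1, Etriangle g2 h, g = g2 ∘ g1 & compatible g1].

Definition left_exact_triangle_seq A B C D
    (f : hom A B) (g : hom B C) (h : hom C D) : Prop :=
  exists M (g1 : hom B M) (g2 : hom M C),
    [/\ Etriangle f g1, Etriangle g2 h, g = g2 ∘ g1 & compatible g2].

End ExtriangulatedNotions.

Record addFunctor (C D : preaddCat) := AddFunctor {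
  fob :> C -> D;
  fmor : forall X Y : C, hom X Y -> hom (fob X) (fob Y);
  fmor_id : forall X : C, fmor (idm X) = idm (fob X);
  fmor_comp : forall (X Y Z : C) (g : hom Y Z) (f : hom X Y),
    fmor (g ∘ f) = fmor g ∘ fmor f;
  fmor_add : forall (X Y : C) (f f' : hom X Y),
    fmor (f + f') = fmor f + fmor f'
}.
Arguments fmor {C D} a {X Y} f.

Definition image_class (C D : preaddCat) (F : addFunctor C D) (P : set C) :
    set D :=
  [set Y | exists2 X, P X & isomorphic (F X) Y].

Definition fully_faithful (C D : preaddCat) (F : addFunctor C D) : Prop :=
  forall X Y : C, bijective (fmor F : hom X Y -> hom (F X) (F Y)).

Section ExactFunctors.
Variables (K L : extriCat) (F : addFunctor K L).

Definition preserves_compatible : Prop :=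
  forall (A B : K) (f : hom A B), compatible f -> compatible (fmor F f).

Definition right_exact_functor : Prop :=
  preserves_compatible /\
  forall (A B C : K) (f : hom A B) (g : hom B C),
    right_exact_seq f g -> right_exact_seq (fmor F f) (fmor F g).

Definition left_exact_functor : Prop :=
  preserves_compatible /\
  forall (A B C : K) (f : hom A B) (g : hom B C),
    left_exact_seq f g -> left_exact_seq (fmor F f) (fmor F g).

Definition exact_functor : Prop :=
  preserves_compatible /\
  exists eta : forall C A : K, ext C A -> ext (F C) (F A),
    [/\ forall (C A : K) (d d' : ext C A),
          eta C A (d + d') = eta C A d + eta C A d',
        forall (C C' A : K) (c : hom C' C) (d : ext C A),
          eta C' A (pull c d) = pull (fmor F c) (eta C A d),
        forall (C A A' : K) (a : hom A A') (d : ext C A),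
          eta C A' (push a d) = push (fmor F a) (eta C A d)
      & forall (A B C : K) (d : ext C A) (x : hom A B) (y : hom B C),
          realizes d x y -> realizes (eta C A d) (fmor F x) (fmor F y)].

End ExactFunctors.

(* [adjunction F G] : F is left adjoint to G *)
Record adjunction (C D : preaddCat) (F : addFunctor C D) (G : addFunctor D C) :=
  Adjunction {
    unit_adj : forall X : C, hom X (G (F X));
    counit_adj : forall Y : D, hom (F (G Y)) Y;
    unit_nat : forall (X X' : C) (f : hom X X'),
      unit_adj X' ∘ f = fmor G (fmor F f) ∘ unit_adj X;
    counit_nat : forall (Y Y' : D) (g : hom Y Y'),
      g ∘ counit_adj Y = counit_adj Y' ∘ fmor F (fmor G g);
    triangle_l : forall X : C,
      counit_adj (F X) ∘ fmor F (unit_adj X) = idm (F X);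
    triangle_r : forall Y : D,
      fmor G (counit_adj Y) ∘ unit_adj (G Y) = idm (G Y)
  }.
Arguments unit_adj {C D F G} a X.
Arguments counit_adj {C D F G} a Y.

Record recollement (A B C : extriCat) := Recollement {
  i_upper_star : addFunctor B A;
  i_lower_star : addFunctor A B;
  i_upper_shriek : addFunctor B A;
  j_lower_shriek : addFunctor C B;
  j_upper_star : addFunctor B C;
  j_lower_star : addFunctor C B;
  i_lower_star_exact : exact_functor i_lower_star;
  j_upper_star_exact : exact_functor j_upper_star;
  i_upper_star_right_exact : right_exact_functor i_upper_star;
  j_lower_shriek_right_exact : right_exact_functor j_lower_shriek;
  i_upper_shriek_left_exact : left_exact_functor i_upper_shriek;
  j_lower_star_left_exact : left_exact_functor j_lower_star;
  adj_i_star : adjunction i_upper_star i_lower_star;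
  adj_i_shriek : adjunction i_lower_star i_upper_shriek;
  adj_j_shriek : adjunction j_lower_shriek j_upper_star;
  adj_j_star : adjunction j_upper_star j_lower_star;
  im_i_ker_j : forall X : B,
    (exists Y : A, isomorphic (i_lower_star Y) X) <-> is_zero (j_upper_star X);
  i_lower_star_ff : fully_faithful i_lower_star;
  j_lower_shriek_ff : fully_faithful j_lower_shriek;
  j_lower_star_ff : fully_faithful j_lower_star;
  recollement_left : forall X : B,
    exists (Y : A) (h : hom (j_lower_star (j_upper_star X)) (i_lower_star Y)),
      left_exact_triangle_seq (counit_adj adj_i_shriek X) (unit_adj adj_j_star X) h;
  recollement_right : forall X : B,
    exists (Y : A) (h : hom (i_lower_star Y) (j_lower_shriek (j_upper_star X))),
      right_exact_triangle_seq h (counit_adj adj_j_shriek X) (unit_adj adj_i_star X)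
}.

Section Cotorsion.
Variable K : extriCat.
Implicit Types X Y : set K.

Fixpoint has_resolution X (m : nat) (C : K) : Prop :=
  if m is m'.+1 then
    exists (M X0 : K) (u : hom M X0) (v : hom X0 C),
      [/\ Etriangle u v, X X0 & has_resolution X m' M]
  else X C.

Fixpoint has_coresolution X (m : nat) (C : K) : Prop :=
  if m is m'.+1 then
    exists (X0 M : K) (u : hom C X0) (v : hom X0 M),
      [/\ Etriangle u v, X X0 & has_coresolution X m' M]
  else X C.

Definition res_le X (m : nat) : set K :=
  [set C | exists2 k, (k <= m)%N & has_resolution X k C].

Definition cores_le X (m : nat) : set K :=
  [set C | exists2 k, (k <= m)%N & has_coresolution X k C].

Variable enI : enough_injectives K.

(* E^{k+1}(X, Y) = 0 *)
Definition extS_vanish (k : nat) X Y : Prop :=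
  forall A B : K, X A -> Y B -> forall d : extS enI k A B, d = 0.

Definition left_cotorsion_pair (n : nat) X Y : Prop :=
  [/\ summand_closed X,
      forall k : nat, (k < n)%N -> extS_vanish k X Y
    & forall C : K, exists (M X0 : K) (u : hom M X0) (v : hom X0 C),
        [/\ Etriangle u v, X X0 & res_le Y n.-1 M]].

Definition right_cotorsion_pair (n : nat) X Y : Prop :=
  [/\ summand_closed Y,
      forall k : nat, (k < n)%N -> extS_vanish k X Y
    & forall C : K, exists (Y0 M : K) (u : hom C Y0) (v : hom Y0 M),
        [/\ Etriangle u v, Y Y0 & cores_le X n.-1 M]].

Definition cotorsion_pair (n : nat) X Y : Prop :=
  left_cotorsion_pair n X Y /\ right_cotorsion_pair n X Y.

Definition hereditary_cotorsion_pair (n : nat) X Y : Prop :=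
  cotorsion_pair n X Y /\ extS_vanish n X Y.

End Cotorsion.

(* Main.v *)
(* A class in an n-cotorsion pair is the E^k-orthogonal (1 <= k <= n) of the other
   one.  With i^* and i^! exact, j_! and j_* preserve E-triangles too, so that in each of
   the four adjunctions L -| G both functors do, and E^k(L X, Y) vanishes exactly when
   E^k(X, G Y) does.  This gives both the vanishing conditions in A and C and the
   descriptions i^*T = {Z | i_* Z in T}, i^!F = {Z | i_* Z in F},
   j^*T = {W | j_! W in T}, j^*F = {W | j_* W in F}, hence closure under summands.  The
   approximations of an object Z of A are obtained by applying i^* to those of i_* Z
   (here i_*i^*F <= F says that i^*F is contained in i^!F), and those of an object W of C
   by applying j^* to those of j_! W or j_* W. *)

From mathcomp Require Import all_boot all_algebra.
From mathcomp Require Import boolp classical_sets.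
Require Import Defs.
Set Implicit Arguments.
Unset Strict Implicit.
Unset Printing Implicit Defensive.
Import GRing.Theory.
Local Open Scope classical_set_scope.
Local Open Scope ring_scope.

(** * Additive categories and adjunctions *)

Lemma additive_map0 (U V : zmodType) (f : U -> V) :
  {morph f : x y / x + y} -> f 0 = 0.
Proof. by move=> fD; apply: (@addrI _ (f 0)); rewrite -fD !addr0. Qed.

Lemma additive_mapN (U V : zmodType) (f : U -> V) :
  {morph f : x y / x + y} -> {morph f : x / - x}.
Proof.
by move=> fD x; apply: (@addrI _ (f x)); rewrite -fD !subrr additive_map0.
Qed.

Section Preadditive.
Variable C : preaddCat.

Lemma comp0l (X Y Z : C) (f : hom X Y) : (0 : hom Y Z) ∘ f = 0.
Proof. by apply: (@additive_map0 _ _ (fun g => g ∘ f)) => g g'; apply: comp_addl. Qed.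

Lemma comp0r (X Y Z : C) (g : hom Y Z) : g ∘ (0 : hom X Y) = 0.
Proof. by apply: (@additive_map0 _ _ (comp g)) => f f'; apply: comp_addr. Qed.

Lemma compBl (X Y Z : C) (g g' : hom Y Z) (f : hom X Y) :
  (g - g') ∘ f = g ∘ f - g' ∘ f.
Proof.
rewrite comp_addl; congr (_ + _).
by apply: (@additive_mapN _ _ (fun h => h ∘ f)) => h h'; apply: comp_addl.
Qed.

Lemma compBr (X Y Z : C) (g : hom Y Z) (f f' : hom X Y) :
  g ∘ (f - f') = g ∘ f - g ∘ f'.
Proof.
rewrite comp_addr; congr (_ + _).
by apply: (@additive_mapN _ _ (comp g)) => h h'; apply: comp_addr.
Qed.

Lemma is_zeroP (Z : C) : is_zero Z <-> idm Z = 0.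
Proof.
split=> [[+ _]|id0]; first exact.
by split=> X f; [rewrite -[f]comp_idr | rewrite -[f]comp_idl];
  rewrite id0 ?comp0l ?comp0r.
Qed.

Lemma is_iso_id (X : C) : is_iso (idm X).
Proof. by exists (idm X); rewrite comp_idl. Qed.

Lemma isomorphic_refl (X : C) : isomorphic X X.
Proof. by exists (idm X); apply: is_iso_id. Qed.

Lemma isomorphic_sym (X Y : C) : isomorphic X Y -> isomorphic Y X.
Proof. by move=> [f [g [gf fg]]]; exists g, f. Qed.

Lemma isomorphic_zero (X Y : C) : isomorphic X Y -> is_zero X -> is_zero Y.
Proof.
move=> [f [g [gf fg]]] [z _]; apply/is_zeroP.
by rewrite -fg (z _ f) comp0l.
Qed.

Lemma is_iso_split (X Y : C) (f : hom X Y) (l r : hom Y X) :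
  l ∘ f = idm X -> f ∘ r = idm Y -> is_iso f.
Proof.
move=> lf fr; suff lr : l = r by exists l; rewrite {2}lr.
by rewrite -[l]comp_idr -fr comp_assoc lf comp_idl.
Qed.

(* [g ∘ f] and [f ∘ g] are invertible, so [f] is both split mono and split epi. *)
Lemma is_iso_two_sided (X Y : C) (f : hom X Y) (g : hom Y X) :
  is_iso (g ∘ f) -> is_iso (f ∘ g) -> is_iso f.
Proof.
move=> [u [u1 _]] [v [_ v2]].
by apply: (@is_iso_split _ _ _ (u ∘ g) (g ∘ v)); rewrite -?comp_assoc // comp_assoc.
Qed.

Definition biprod_swap (X Y : C) (S : biprod X Y) : biprod Y X :=
  Biprod (pr2_in2 S) (pr1_in1 S) (pr2_in1 S) (pr1_in2 S)
    (etrans (addrC _ _) (biprod_id S)).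

End Preadditive.

Section Functors.
Variables (C D : preaddCat) (G : addFunctor C D).

Lemma fmor0 (X Y : C) : fmor G (0 : hom X Y) = 0.
Proof. by apply: additive_map0 => f f'; apply: fmor_add. Qed.

Lemma is_zero_fob (X : C) : is_zero X -> is_zero (G X).
Proof. by move=> /is_zeroP X0; apply/is_zeroP; rewrite -fmor_id X0 fmor0. Qed.

Lemma is_iso_fmor (X Y : C) (f : hom X Y) : is_iso f -> is_iso (fmor G f).
Proof. by move=> [g [gf fg]]; exists (fmor G g); rewrite -!fmor_comp gf fg !fmor_id. Qed.

Lemma isomorphic_fob (X Y : C) : isomorphic X Y -> isomorphic (G X) (G Y).
Proof. by move=> [f fi]; exists (fmor G f); apply: is_iso_fmor. Qed.

Lemma fob_biprod (X Y : C) (S : biprod X Y) :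
  exists S' : biprod (G X) (G Y), S' = G S :> D.
Proof.
unshelve eexists.
  apply: (@Biprod D (G X) (G Y) (G S) (fmor G (in1 S)) (fmor G (in2 S))
    (fmor G (pr1 S)) (fmor G (pr2 S))); rewrite -!fmor_comp.
  - by rewrite pr1_in1 fmor_id.
  - by rewrite pr2_in2 fmor_id.
  - by rewrite pr1_in2 fmor0.
  - by rewrite pr2_in1 fmor0.
  - by rewrite -fmor_add biprod_id fmor_id.
by [].
Qed.

Lemma image_class_fob (P : set C) (X : C) : P X -> image_class G P (G X).
Proof. by move=> PX; exists X => //; apply: isomorphic_refl. Qed.

End Functors.

Section Adjunctions.
Variables (C D : preaddCat) (L : addFunctor C D) (G : addFunctor D C).
Variable adj : adjunction L G.

(** The inverse is the preimage under [G] of the unit at [G Y]: one triangle identity gives one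
    composite, and the other follows by faithfulness. *)
Lemma counit_iso_of_ff : fully_faithful G -> forall Y : D, is_iso (counit_adj adj Y).
Proof.
move=> ff Y; have [g gK Kg] := ff Y (L (G Y)).
have := Kg (unit_adj adj (G Y)); move: (g _) => s Gs {g gK Kg}.
exists s; split; first by rewrite counit_nat Gs triangle_l.
by apply: (bij_inj (ff Y Y)); rewrite fmor_comp Gs triangle_r fmor_id.
Qed.

Lemma unit_iso_of_ff : fully_faithful L -> forall X : C, is_iso (unit_adj adj X).
Proof.
move=> ff X; have [g gK Kg] := ff (G (L X)) X.
have := Kg (counit_adj adj (L X)); move: (g _) => r Lr {g gK Kg}.
exists r; split; last by rewrite unit_nat Lr triangle_r.
by apply: (bij_inj (ff X X)); rewrite fmor_comp Lr triangle_l fmor_id.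
Qed.

(** Every [f] is the double transpose [counit ∘ L (G f ∘ unit)], whose inner factor is a map from
    [X] to [G Y]. *)
Lemma hom_left_adj0 (X : C) (Y : D) :
  (forall g : hom X (G Y), g = 0) -> forall f : hom (L X) Y, f = 0.
Proof.
move=> g0 f; rewrite -[f]comp_idr -(triangle_l adj) comp_assoc counit_nat.
by rewrite -comp_assoc -fmor_comp [X in fmor L X]g0 fmor0 comp0r.
Qed.

Lemma hom_right_adj0 (X : C) (Y : D) :
  (forall f : hom (L X) Y, f = 0) -> forall g : hom X (G Y), g = 0.
Proof.
move=> f0 g; rewrite -[g]comp_idl -(triangle_r adj) -comp_assoc unit_nat.
by rewrite comp_assoc -fmor_comp [X in fmor G X]f0 fmor0 comp0l.
Qed.

End Adjunctions.

(** * Extriangulated categories *)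

Section Triangles.
Variable K : extriCat.

Lemma push0 (X X' Z : K) (a : hom X X') : push a (0 : ext Z X) = 0.
Proof. by apply: additive_map0 => d d'; apply: push_add. Qed.

Lemma pull0 (X Z Z' : K) (c : hom Z' Z) : pull c (0 : ext Z X) = 0.
Proof. by apply: additive_map0 => d d'; apply: pull_add. Qed.

Lemma push0m (X X' Z : K) (d : ext Z X) : push (0 : hom X X') d = 0.
Proof. by apply: (@additive_map0 _ _ (fun a => push a d)) => a a'; apply: push_addm. Qed.

Lemma pull0m (X Z Z' : K) (d : ext Z X) : pull (0 : hom Z' Z) d = 0.
Proof. by apply: (@additive_map0 _ _ (fun c => pull c d)) => c c'; apply: pull_addm. Qed.

(** The triangle X -> X ⊕ 0 -> 0 serves as a test object: comparing it with an arbitrary triangle by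
    [ET3] or [ET3op] yields the exactness facts below. *)
Lemma split_triangle_left (X : K) :
  exists (Z S : K) (x : hom X S) (y : hom S Z) (r : hom S X),
  [/\ realizes 0 x y, r ∘ x = idm X & is_zero Z].
Proof.
have [Z Z0] := has_zero K; have [S] := has_biprod X Z.
by exists Z, S, (in1 S), (pr2 S), (pr1 S); split=> //;
  [apply: real_zero | apply: pr1_in1].
Qed.

Lemma split_triangle_right (X : K) :
  exists (Z S : K) (x : hom Z S) (y : hom S X) (s : hom X S),
  [/\ realizes 0 x y, y ∘ s = idm X & is_zero Z].
Proof.
have [Z Z0] := has_zero K; have [S] := has_biprod Z X.
by exists Z, S, (in1 S), (pr2 S), (in2 S); split=> //;
  [apply: real_zero | apply: pr2_in2].
Qed.

(** * Exactness properties of a single triangle *)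

Section OneTriangle.
Variables (X Y Z : K) (x : hom X Y) (y : hom Y Z).

Lemma Etriangle_comp0 : Etriangle x y -> y ∘ x = 0.
Proof.
move=> [d dxy].
have [O [S [u [v [r [uv ru [O0 _]]]]]]] := split_triangle_left X.
(* Mapping the test triangle to the given one makes [y ∘ x] factor through the zero object [O]. *)
have [|c [_ yb]] := @ET3 K _ _ _ _ _ _ _ _ _ _ _ _ (idm X) (x ∘ r) uv dxy.
  by rewrite -comp_assoc ru.
by rewrite -[x]comp_idr -ru comp_assoc comp_assoc -(comp_assoc y) yb (O0 _ c) !comp0l.
Qed.

Lemma lift_inflation (W : K) (f : hom W Y) :
  Etriangle x y -> y ∘ f = 0 -> exists g : hom W X, x ∘ g = f.
Proof.
move=> [d dxy] yf.
have [O [S [u [v [r [uv ru O0]]]]]] := split_triangle_left W.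
have [|a [_ fa]] := @ET3op K _ _ _ _ _ _ _ _ _ _ _ _ (f ∘ r) (0 : hom O Z) uv dxy.
  by rewrite comp_assoc yf !comp0l.
by exists a; rewrite -fa -comp_assoc ru comp_idr.
Qed.

Lemma colift_deflation (W : K) (f : hom Y W) :
  Etriangle x y -> f ∘ x = 0 -> exists g : hom Z W, g ∘ y = f.
Proof.
move=> [d dxy] fx.
have [O [S [u [v [s [uv vs O0]]]]]] := split_triangle_right W.
have [|c [_ fc]] := @ET3 K _ _ _ _ _ _ _ _ _ _ _ _ (0 : hom X O) (s ∘ f) dxy uv.
  by rewrite -comp_assoc fx !comp0r.
by exists c; rewrite -fc comp_assoc vs comp_idl.
Qed.

Variable d : ext Z X.
Hypothesis dxy : realizes d x y.

(** The tautological square on [x] and [u] maps the triangle to a split one, so the pushed class is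
    a pullback of 0. *)
Lemma push_inflation : push x d = 0.
Proof.
have [O [S [u [v [r [uv ru [_ O0]]]]]]] := split_triangle_left Y.
have [//|c [-> _]] := @ET3 K _ _ _ _ _ _ _ _ _ _ _ _ x u dxy uv.
exact: pull0.
Qed.

Lemma pull_deflation : pull y d = 0.
Proof.
have [O [S [u [v [s [uv vs O0]]]]]] := split_triangle_right Y.
have [//|a [<- _]] := @ET3op K _ _ _ _ _ _ _ _ _ _ _ _ v y uv dxy.
exact: push0.
Qed.

(** If the pullback vanishes, [(idm X, c)] is a morphism from the split extension of [W] by [X] to
    [d]; its middle component, restricted to [W], is the lift. *)
Lemma pull_eq0 (W : K) (c : hom W Z) : pull c d = 0 <-> exists g : hom W Y, y ∘ g = c.
Proof.
split=> [cd | [g <-]]; last by rewrite pull_comp pull_deflation pull0.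
have [S] := has_biprod X W.
have [|b [_ yb]] := real_mor (real_zero S) dxy (a := idm X) (c := c).
  by rewrite cd push0.
by exists (b ∘ in2 S); rewrite comp_assoc yb -comp_assoc pr2_in2 comp_idr.
Qed.

Lemma push_eq0 (W : K) (a : hom X W) : push a d = 0 <-> exists g : hom Y W, g ∘ x = a.
Proof.
split=> [ad | [g <-]]; last by rewrite push_comp push_inflation push0.
have [S] := has_biprod W Z.
have [|b [bx _]] := real_mor dxy (real_zero S) (a := a) (c := idm Z).
  by rewrite ad pull0.
by exists (pr1 S ∘ b); rewrite -comp_assoc bx comp_assoc pr1_in1 comp_idl.
Qed.

Lemma retraction_of_ext0 : d = 0 -> exists r : hom Y X, r ∘ x = idm X.
Proof. by move=> d0; apply/push_eq0; rewrite push_id. Qed.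

Lemma section_of_ext0 : d = 0 -> exists s : hom Z Y, y ∘ s = idm Z.
Proof. by move=> d0; apply/pull_eq0; rewrite pull_id. Qed.

End OneTriangle.

(** * Zero terms, invertible maps and isomorphisms of triangles *)

Lemma ext_to_zero (X Z : K) (d : ext Z X) : is_zero X -> d = 0.
Proof. by move=> /is_zeroP X0; rewrite -[d]push_id X0 push0m. Qed.

Lemma ext_from_zero (X Z : K) (d : ext Z X) : is_zero Z -> d = 0.
Proof. by move=> /is_zeroP Z0; rewrite -[d]pull_id Z0 pull0m. Qed.

Lemma iso_of_cone_zero (X Y Z : K) (x : hom X Y) (y : hom Y Z) :
  Etriangle x y -> is_zero Z -> is_iso x.
Proof.
move=> xy Z0; have [d dxy] := xy.
have [r rx] := retraction_of_ext0 dxy (ext_from_zero d Z0).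
have [|s xs] := lift_inflation (f := idm Y) xy; first exact: Z0.2.
exact: is_iso_split rx xs.
Qed.

Lemma iso_of_cocone_zero (X Y Z : K) (x : hom X Y) (y : hom Y Z) :
  Etriangle x y -> is_zero X -> is_iso y.
Proof.
move=> xy X0; have [d dxy] := xy.
have [s ys] := section_of_ext0 dxy (ext_to_zero d X0).
have [|r ry] := colift_deflation (f := idm Y) xy; first exact: X0.1.
exact: is_iso_split ry ys.
Qed.

(** Pushing along [x] kills [d], so an invertible [x] forces [d = 0]. Then [y] has a section, while
    [y ∘ x = 0] makes [y] itself zero. *)
Lemma cone_zero_of_iso (X Y Z : K) (x : hom X Y) (y : hom Y Z) :
  Etriangle x y -> is_iso x -> is_zero Z.
Proof.
move=> xy [r [rx xr]]; have [d dxy] := xy.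
have d0 : d = 0 by rewrite -[d]push_id -rx push_comp (push_inflation dxy) push0.
have [s ys] := section_of_ext0 dxy d0; apply/is_zeroP.
by rewrite -ys -[y]comp_idr -xr comp_assoc (Etriangle_comp0 xy) !comp0l.
Qed.

Lemma cocone_zero_of_iso (X Y Z : K) (x : hom X Y) (y : hom Y Z) :
  Etriangle x y -> is_iso y -> is_zero X.
Proof.
move=> xy [s [sy ys]]; have [d dxy] := xy.
have d0 : d = 0 by rewrite -[d]pull_id -ys pull_comp (pull_deflation dxy) pull0.
have [r rx] := retraction_of_ext0 dxy d0; apply/is_zeroP.
by rewrite -rx -[x]comp_idl -sy -comp_assoc (Etriangle_comp0 xy) !comp0r.
Qed.

Lemma is_iso_1D_square_zero (Y : K) (f : hom Y Y) : f ∘ f = 0 -> is_iso (idm Y + f).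
Proof.
move=> ff; exists (idm Y - f).
by rewrite compBl compBr !(comp_addl, comp_addr, comp_idl, comp_idr) ff addr0 addrK.
Qed.

(* [e - 1] factors through [y] and is killed by [y], so it squares to zero. *)
Lemma triangle_endo_iso (X Y Z : K) (x : hom X Y) (y : hom Y Z) (e : hom Y Y) :
  Etriangle x y -> e ∘ x = x -> y ∘ e = y -> is_iso e.
Proof.
move=> xy ex ye.
have [|g gy] := colift_deflation (f := e - idm Y) xy.
  by rewrite compBl ex comp_idl subrr.
have -> : e = idm Y + (e - idm Y) by rewrite addrC subrK.
apply: is_iso_1D_square_zero.
by rewrite -{1}gy -comp_assoc compBr ye comp_idr subrr comp0r.
Qed.

(** The map [b'] over the inverses of [a] and [c] need not invert [b], but both composites fix the
    two maps of a triangle, so [triangle_endo_iso] applies to them. *)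
Lemma triangle_mor_iso (X Y Z X' Y' Z' : K) (d : ext Z X) (d' : ext Z' X')
    (x : hom X Y) (y : hom Y Z) (x' : hom X' Y') (y' : hom Y' Z')
    (a : hom X X') (c : hom Z Z') (b : hom Y Y') :
  realizes d x y -> realizes d' x' y' -> push a d = pull c d' ->
  is_iso a -> is_iso c -> b ∘ x = x' ∘ a -> y' ∘ b = c ∘ y -> is_iso b.
Proof.
move=> dxy dxy' ad [a' [aa a'a]] [c' [cc c'c]] bx yb.
have [|b' [bx' yb']] := real_mor dxy' dxy (a := a') (c := c').
  by rewrite -[d']pull_id -c'c pull_comp -ad push_pull -push_comp aa push_id.
apply: (@is_iso_two_sided _ _ _ b b').
  apply: (@triangle_endo_iso _ _ _ x y); first by exists d.
    by rewrite -comp_assoc bx comp_assoc bx' -comp_assoc aa comp_idr.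
  by rewrite comp_assoc yb' -comp_assoc yb comp_assoc cc comp_idl.
apply: (@triangle_endo_iso _ _ _ x' y'); first by exists d'.
  by rewrite -comp_assoc bx' comp_assoc bx -comp_assoc a'a comp_idr.
by rewrite comp_assoc yb -comp_assoc yb' comp_assoc c'c comp_idl.
Qed.

(** The class transported along [a] and [c] is realized on some [Y']; [triangle_mor_iso] identifies
    [Y] with [Y'], and [real_class] carries the realization back to [Y]. *)
Lemma Etriangle_iso_ends (X Y Z X' Z' : K) (x : hom X Y) (y : hom Y Z)
    (a : hom X' X) (c : hom Z Z') :
  Etriangle x y -> is_iso a -> is_iso c -> Etriangle (x ∘ a) (c ∘ y).
Proof.
move=> [d dxy] [a' [a'a aa']] [c' [c'c cc']].
have [Y' [x' [y' dxy']]] := real_ex (push a' (pull c' d)).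
have ad : push a' d = pull c (push a' (pull c' d)).
  by rewrite -push_pull -pull_comp c'c pull_id.
have [b [bx yb]] := real_mor dxy dxy' ad.
have [||b' [b'b bb']] := triangle_mor_iso dxy dxy' ad _ _ bx yb.
- by exists a.
- by exists c'.
exists (push a' (pull c' d)); apply/(real_class _ _ dxy').
exists b'; split; first by exists b.
split; last by rewrite -yb -comp_assoc bb' comp_idr.
by rewrite -[x']comp_idr -a'a (comp_assoc x') -bx !comp_assoc b'b comp_idl.
Qed.

Lemma Etriangle_iso (X Y Z X' Y' Z' : K) (x : hom X Y) (y : hom Y Z)
    (x' : hom X' Y') (y' : hom Y' Z') (a : hom X X') (b : hom Y Y') (c : hom Z Z') :
  Etriangle x y -> is_iso a -> is_iso b -> is_iso c ->
  b ∘ x = x' ∘ a -> y' ∘ b = c ∘ y -> Etriangle x' y'.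
Proof.
move=> xy [a' [a'a aa']] bi ci bx yb.
have [|d dxy] := Etriangle_iso_ends (a := a') (c := c) xy _ ci; first by exists a.
exists d; apply/(real_class _ _ dxy); exists b; split=> //; split=> //.
by rewrite comp_assoc bx -comp_assoc aa' comp_idr.
Qed.

Lemma Etriangle_iso_inv (X Y Z X' Y' Z' : K) (x : hom X Y) (y : hom Y Z)
    (x' : hom X' Y') (y' : hom Y' Z') (a : hom X X') (b : hom Y Y') (c : hom Z Z') :
  Etriangle x' y' -> is_iso a -> is_iso b -> is_iso c ->
  b ∘ x = x' ∘ a -> y' ∘ b = c ∘ y -> Etriangle x y.
Proof.
move=> xy' [a' [a'a aa']] [b' [b'b bb']] [c' [c'c cc']] bx yb.
apply: (@Etriangle_iso _ _ _ _ _ _ x' y' x y a' b' c' xy'); first by exists a.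
- by exists b.
- by exists c.
- by rewrite -[x']comp_idr -aa' (comp_assoc x') -bx !comp_assoc b'b comp_idl.
- by rewrite -[y']comp_idr -bb' (comp_assoc y') yb !comp_assoc c'c comp_idl.
Qed.

Lemma inflation_id (X : K) : inflation (idm X).
Proof.
have [Z [S [x [y [r [dxy rx Z0]]]]]] := split_triangle_left X.
have xy : Etriangle x y by exists 0.
exists Z, (y ∘ x).
apply: (Etriangle_iso_inv (b := x) xy) (is_iso_id X) _ (is_iso_id Z) _ _.
- exact: iso_of_cone_zero xy Z0.
- by [].
- by rewrite comp_idl.
Qed.

Lemma deflation_id (X : K) : deflation (idm X).
Proof.
have [Z [S [x [y [r [dxy rx Z0]]]]]] := split_triangle_right X.
have xy : Etriangle x y by exists 0.
exists Z, (y ∘ x).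
apply: (Etriangle_iso (b := y) xy) (is_iso_id Z) _ (is_iso_id X) _ _.
- exact: iso_of_cocone_zero xy Z0.
- by rewrite comp_idr.
- by [].
Qed.

(** Allows a left exact functor, which is only required to preserve left exact sequences, to be
    applied to an E-triangle. *)
Lemma Etriangle_left_exact (X Y Z : K) (x : hom X Y) (y : hom Y Z) :
  Etriangle x y -> left_exact_seq x y.
Proof.
move=> xy; exists Z, y, (idm Z); split=> //; first exact: inflation_id.
  by move=> _ _; apply: is_iso_id.
by rewrite comp_idl.
Qed.

Lemma Etriangle_right_exact (X Y Z : K) (x : hom X Y) (y : hom Y Z) :
  Etriangle x y -> right_exact_seq x y.
Proof.
move=> xy; exists X, x, (idm X); split=> //; first exact: deflation_id.
  by move=> _ _; apply: is_iso_id.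
by rewrite comp_idr.
Qed.

Lemma cone_zero (X Y Z : K) (x : hom X Y) (y : hom Y Z) :
  Etriangle x y -> is_zero X -> is_zero Y -> is_zero Z.
Proof.
by move=> xy X0; apply: isomorphic_zero; exists y; apply: iso_of_cocone_zero xy X0.
Qed.

Lemma cocone_zero (X Y Z : K) (x : hom X Y) (y : hom Y Z) :
  Etriangle x y -> is_zero Y -> is_zero Z -> is_zero X.
Proof.
move=> xy Y0 Z0; apply: isomorphic_zero Y0.
by apply: isomorphic_sym; exists x; apply: iso_of_cone_zero xy Z0.
Qed.

(** Realizations of 0 form one equivalence class, which identifies [Y] with X ⊕ Z. *)
Lemma split_triangle_summand (P : set K) (X Y Z : K) (x : hom X Y) (y : hom Y Z) :
  realizes (0 : ext Z X) x y -> iso_closed P -> summand_closed P ->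
  P Y -> P X /\ P Z.
Proof.
move=> xy isoP sumP PY; have [S] := has_biprod X Z.
have [b [bi _]] := proj1 (real_class (in1 S) (pr2 S) xy) (real_zero S).
have PS : P S by apply: isoP PY; exists b.
by split; [apply: (sumP _ _ S) | apply: (sumP _ _ (biprod_swap S))].
Qed.

(** * Vanishing of extensions and dimension shifting *)

Definition ext_vanish (X Y : K) : Prop := forall d : ext X Y, d = 0.

Lemma ext_vanish_push_eq0 (X Y Z W : K) (a : hom Y Z) (b : hom Y W) (c : hom W Z) :
  c ∘ b = a -> ext_vanish X W -> forall d : ext X Y, push a d = 0.
Proof. by move=> <- XW d; rewrite push_comp (XW (push b d)) push0. Qed.

Lemma ext_vanish_pull_eq0 (X Y Z W : K) (c : hom Z X) (b : hom Z W) (e : hom W X) :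
  e ∘ b = c -> ext_vanish W Y -> forall d : ext X Y, pull c d = 0.
Proof. by move=> <- WY d; rewrite pull_comp (WY (pull e d)) pull0. Qed.

Lemma ext_vanish_isol (X X' Y : K) : isomorphic X X' -> ext_vanish X Y -> ext_vanish X' Y.
Proof.
by move=> [f [g [_ fg]]] XY d; rewrite -[d]pull_id; exact: (ext_vanish_pull_eq0 fg XY).
Qed.

Lemma ext_vanish_isor (X Y Y' : K) : isomorphic Y Y' -> ext_vanish X Y -> ext_vanish X Y'.
Proof.
by move=> [f [g [_ fg]]] XY d; rewrite -[d]push_id; exact: (ext_vanish_push_eq0 fg XY).
Qed.

Lemma ext_vanish_injective (X I : K) : injective_ob I -> ext_vanish X I.
Proof.
move=> injI d; have [Y [x [y dxy]]] := real_ex d.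
have [|q qx] := injI _ _ _ x y _ (idm I); first by exists d.
by rewrite -[d]push_id; apply/(push_eq0 dxy); exists q.
Qed.

Lemma ext_vanish_projective (P Y : K) : projective_ob P -> ext_vanish P Y.
Proof.
move=> projP d; have [M [x [y dxy]]] := real_ex d.
have [|q qy] := projP _ _ _ x y _ (idm P); first by exists d.
by rewrite -[d]pull_id; apply/(pull_eq0 dxy); exists q.
Qed.

(** The connecting map is onto: [y] lifts through the deflation of [d], and [ET3op] completes this
    to a morphism of triangles whose left component is [a]. *)
Lemma ext_push_of_syzygy (P D D' X : K) (x : hom D' P) (y : hom P D) (g : ext D D') :
  projective_ob P -> realizes g x y ->
  forall d : ext D X, exists a : hom D' X, d = push a g.
Proof.
move=> projP gxy d; have [M [u [v duv]]] := real_ex d.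
have [|q vq] := projP _ _ _ u v _ y; first by exists d.
have [|a [ag _]] := ET3op (b := q) (c := idm D) gxy duv; first by rewrite comp_idl.
by exists a; rewrite ag pull_id.
Qed.

Lemma ext_pull_of_cosyzygy (I D D' X : K) (x : hom D I) (y : hom I D') (g : ext D' D) :
  injective_ob I -> realizes g x y ->
  forall d : ext X D, exists c : hom X D', d = pull c g.
Proof.
move=> injI gxy d; have [M [u [v duv]]] := real_ex d.
have [|q qu] := injI _ _ _ u v _ x; first by exists d.
have [|c [cg _]] := ET3 (a := idm D) (b := q) duv gxy; first by rewrite comp_idr.
by exists c; rewrite -cg push_id.
Qed.

(* Both groups vanish exactly when every map [X' -> Y'] factors through the
   projective [P], equivalently through the injective [I]. *)
Lemma ext_vanish_syzygy (X X' Y Y' : K) :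
  is_syzygy X X' -> is_cosyzygy Y Y' -> (ext_vanish X Y' <-> ext_vanish X' Y).
Proof.
move=> [P [x [y [projP [g gxy]]]]] [I [u [v [injI [h huv]]]]].
split=> van d.
  have [c ->] := ext_pull_of_cosyzygy injI huv d.
  have /(push_eq0 gxy) [q qx] := van (push c g).
  exact: (ext_vanish_pull_eq0 qx (ext_vanish_projective projP)).
have [c ->] := ext_push_of_syzygy projP gxy d.
have /(pull_eq0 huv) [q qv] := van (pull c h).
exact: (ext_vanish_push_eq0 qv (ext_vanish_injective injI)).
Qed.

(** A class in E(D, N) is pushed from the syzygy along some [a]; the vanishing of E(D', M), which is
    E^2(D, M), lifts [a] to [X0], so the class comes from E(D, X0). *)
Lemma ext_vanish_resolution_step (D D' M X0 N : K) (u : hom M X0) (v : hom X0 N) :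
  Etriangle u v -> is_syzygy D D' ->
  ext_vanish D X0 -> ext_vanish D' M -> ext_vanish D N.
Proof.
move=> [h huv] [P [x [y [projP [g gxy]]]]] DX0 D'M d.
have [a ->] := ext_push_of_syzygy projP gxy d.
have /(pull_eq0 huv) [b vb] := D'M (pull a h).
exact: (ext_vanish_push_eq0 vb DX0).
Qed.

Lemma ext_vanish_coresolution_step (D D' M X0 N : K) (u : hom N X0) (v : hom X0 M) :
  Etriangle u v -> is_cosyzygy D D' ->
  ext_vanish X0 D -> ext_vanish M D' -> ext_vanish N D.
Proof.
move=> [h huv] [I [x [y [injI [g gxy]]]]] X0D MD' d.
have [c ->] := ext_pull_of_cosyzygy injI gxy d.
have /(push_eq0 huv) [b bu] := MD' (push c h).
exact: (ext_vanish_pull_eq0 bu X0D).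
Qed.

(** A relation, since syzygies depend on the chosen triangles. Steps are added at the front here and
    at the end in [nth_cosyzygy], so that an induction can trade the first syzygy for the last
    cosyzygy. *)
Inductive nth_syzygy : nat -> K -> K -> Prop :=
| nth_syzygy0 X : nth_syzygy 0 X X
| nth_syzygyS k X X' X'' :
    is_syzygy X X' -> nth_syzygy k X' X'' -> nth_syzygy k.+1 X X''.

Inductive nth_cosyzygy : nat -> K -> K -> Prop :=
| nth_cosyzygy0 Y : nth_cosyzygy 0 Y Y
| nth_cosyzygyS k Y Y' Y'' :
    nth_cosyzygy k Y Y' -> is_cosyzygy Y' Y'' -> nth_cosyzygy k.+1 Y Y''.

Lemma ext_vanish_nth_syzygy (k : nat) (X X' Y Y' : K) :
  nth_syzygy k X X' -> nth_cosyzygy k Y Y' -> (ext_vanish X Y' <-> ext_vanish X' Y).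
Proof.
move=> sX; elim: sX Y' => {k X X'} [X|k X X' X'' sX _ IH] Y' sY.
  by inversion sY.
inversion sY as [|? ? Y'' ? sY' cY]; subst.
exact: iff_trans (ext_vanish_syzygy sX cY) (IH _ sY').
Qed.

Lemma nth_syzygy_ex (enP : enough_projectives K) k (X : K) : exists X', nth_syzygy k X X'.
Proof.
elim: k X => [|k IH] X; first by exists X; constructor.
have [X' sX] := enP X; have [X'' sX'] := IH X'.
by exists X''; apply: nth_syzygyS sX sX'.
Qed.

(** * Higher extensions and orthogonality in cotorsion pairs *)

Section EnoughInjectives.
Variable enI : enough_injectives K.

Lemma cosyzygyP (X : K) : is_cosyzygy X (cosyzygy enI X).
Proof. by rewrite /cosyzygy; case: cid. Qed.

Lemma nth_cosyzygy_iter k (Y : K) : nth_cosyzygy k Y (iter k (cosyzygy enI) Y).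
Proof. by elim: k => [|k IH]; [constructor | apply: nth_cosyzygyS IH (cosyzygyP _)]. Qed.

(** The condition E^{k+1}(X, Y) = 0 for a single pair of objects. *)
Definition extS_zero (k : nat) (X Y : K) : Prop := ext_vanish X (iter k (cosyzygy enI) Y).

Lemma extS_zero_isol k (X X' Y : K) :
  isomorphic X X' -> extS_zero k X Y -> extS_zero k X' Y.
Proof. exact: ext_vanish_isol. Qed.

Lemma extS_zeroSr k (X Y : K) : extS_zero k.+1 X Y <-> extS_zero k X (cosyzygy enI Y).
Proof. by rewrite /extS_zero iterSr. Qed.

Lemma extS_zeroSl k (X X' Y : K) :
  is_syzygy X X' -> (extS_zero k.+1 X Y <-> extS_zero k X' Y).
Proof. by move=> sX; apply: ext_vanish_syzygy sX (cosyzygyP _). Qed.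

(** Each step of the coresolution replaces [D] by its cosyzygy, which raises the degree of the
    required vanishing by one. *)
Lemma ext_vanish_coresolution (P : set K) m (D N : K) :
  has_coresolution P m N ->
  (forall k X, (k <= m)%N -> P X -> extS_zero k X D) -> ext_vanish N D.
Proof.
elim: m D N => [|m IH] D N /=; first by move=> PN /(_ 0%N N (leqnn _) PN).
move=> [X0 [M [u [v [uv PX0 resM]]]]] van.
apply: ext_vanish_coresolution_step uv (cosyzygyP D) (van 0%N X0 _ PX0) _ => //.
by apply: IH resM _ => k X km PX; apply/extS_zeroSr; apply: van.
Qed.

(** The approximation of [D] splits because E(M, D) = 0, so [D] is a summand of an object of [Q]. *)
Lemma right_cotorsion_pair_perp n (P Q : set K) (D : K) :
  (1 <= n)%N -> iso_closed Q -> right_cotorsion_pair enI n P Q ->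
  (forall k X, (k < n)%N -> P X -> extS_zero k X D) -> Q D.
Proof.
move=> n_ge1 isoQ [sumQ _ /(_ D) [Y0 [M [u [v [[d duv] QY0 [m mn resM]]]]]]] van.
have d0 : d = 0.
  apply: (ext_vanish_coresolution resM) => k X km; apply: van.
  (* Here [m <= n.-1], and [1 <= n] turns [k <= m] into [k < n]. *)
  by rewrite -(prednK n_ge1) ltnS (leq_trans km).
by rewrite d0 in duv; have [] := split_triangle_summand duv isoQ sumQ QY0.
Qed.

Hypothesis enP : enough_projectives K.

(** Independence of the chosen cosyzygies: both sides amount to the vanishing of E(X', Y) for a
    [k]-th syzygy [X'] of [X]. *)
Lemma extS_zero_cosyzygy k (X Y Y' : K) :
  nth_cosyzygy k Y Y' -> (extS_zero k X Y <-> ext_vanish X Y').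
Proof.
move=> sY; have [X' sX] := nth_syzygy_ex enP k X.
apply: iff_trans (ext_vanish_nth_syzygy sX (nth_cosyzygy_iter k Y)) _.
exact: iff_sym (ext_vanish_nth_syzygy sX sY).
Qed.

(** The cosyzygies of [Y] and [Y'] are chosen separately, so the shift is first moved to [X], where
    the isomorphism acts directly on E. *)
Lemma extS_zero_isor k (X Y Y' : K) :
  isomorphic Y Y' -> extS_zero k X Y -> extS_zero k X Y'.
Proof.
move=> YY'; have [X' sX] := nth_syzygy_ex enP k X.
move=> /(ext_vanish_nth_syzygy sX (nth_cosyzygy_iter k Y)) van.
apply/(ext_vanish_nth_syzygy sX (nth_cosyzygy_iter k Y')).
exact: ext_vanish_isor YY' van.
Qed.

Lemma ext_vanish_resolution (P : set K) m (D N : K) :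
  has_resolution P m N ->
  (forall k Y, (k <= m)%N -> P Y -> extS_zero k D Y) -> ext_vanish D N.
Proof.
elim: m D N => [|m IH] D N /=; first by move=> PN /(_ 0%N N (leqnn _) PN).
move=> [M [X0 [u [v [uv PX0 resM]]]]] van; have [D' sD] := enP D.
apply: (ext_vanish_resolution_step uv sD (van 0%N X0 _ PX0)) => //.
by apply: IH resM _ => k Y km PY; apply/(extS_zeroSl k Y sD); apply: van.
Qed.

(** Dually, the approximation ending in [D] splits, now through the resolution of its first term. *)
Lemma left_cotorsion_pair_perp n (P Q : set K) (D : K) :
  (1 <= n)%N -> iso_closed P -> left_cotorsion_pair enI n P Q ->
  (forall k Y, (k < n)%N -> Q Y -> extS_zero k D Y) -> P D.
Proof.
move=> n_ge1 isoP [sumP _ /(_ D) [M [X0 [u [v [[d duv] PX0 [m mn resM]]]]]]] van.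
have d0 : d = 0.
  apply: (ext_vanish_resolution resM) => k Y km; apply: van.
  by rewrite -(prednK n_ge1) ltnS (leq_trans km).
by rewrite d0 in duv; have [] := split_triangle_summand duv isoP sumP PX0.
Qed.

End EnoughInjectives.
End Triangles.

(** * Exact adjunctions and recollements *)

(** The part of exactness without a natural map on E; it is the form in which exactness of [j_!] and
    [j_*] is obtained below. *)
Definition preserves_Etriangles (K L : extriCat) (G : addFunctor K L) : Prop :=
  forall (X Y Z : K) (x : hom X Y) (y : hom Y Z),
    Etriangle x y -> Etriangle (fmor G x) (fmor G y).

Section TrianglePreservingFunctors.
Variables (K L : extriCat) (G : addFunctor K L).

Lemma exact_preserves_Etriangles : exact_functor G -> preserves_Etriangles G.
Proof.
by move=> [_ [eta [_ _ _ Gr]]] X Y Z x y [d dxy]; exists (eta _ _ d); apply: Gr.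
Qed.

Hypothesis GE : preserves_Etriangles G.

Lemma inflation_fmor (X Y : K) (f : hom X Y) : inflation f -> inflation (fmor G f).
Proof. by move=> [Z [g fg]]; exists (G Z), (fmor G g); apply: GE. Qed.

Lemma deflation_fmor (X Y : K) (f : hom X Y) : deflation f -> deflation (fmor G f).
Proof. by move=> [Z [g fg]]; exists (G Z), (fmor G g); apply: GE. Qed.

Variables (P : set K) (Q : set L).
Hypothesis GPQ : forall X, P X -> Q (G X).

Lemma has_resolution_fob m (X : K) :
  has_resolution P m X -> has_resolution Q m (G X).
Proof.
elim: m X => [|m IH] X /=; first exact: GPQ.
move=> [M [X0 [u [v [uv PX0 /IH resM]]]]].
by exists (G M), (G X0), (fmor G u), (fmor G v); split=> //; [apply: GE | apply: GPQ].
Qed.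

Lemma has_coresolution_fob m (X : K) :
  has_coresolution P m X -> has_coresolution Q m (G X).
Proof.
elim: m X => [|m IH] X /=; first exact: GPQ.
move=> [X0 [M [u [v [uv PX0 /IH resM]]]]].
by exists (G X0), (G M), (fmor G u), (fmor G v); split=> //; [apply: GE | apply: GPQ].
Qed.

End TrianglePreservingFunctors.

(** * Adjoint functors that preserve triangles *)

Section ExactAdjunction.
Variables (K L : extriCat) (F : addFunctor K L) (G : addFunctor L K).
Variable adj : adjunction F G.
Hypotheses (FE : preserves_Etriangles F) (GE : preserves_Etriangles G).

(* A lift of the unit [X -> G (F X)] through [G y] is transposed to a section of
   [y]; no compatibility of the action of [G] on extensions with the adjunction is
   needed. *)
Lemma ext_vanish_adj_left (X : K) (Y : L) : ext_vanish X (G Y) -> ext_vanish (F X) Y.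
Proof.
move=> van d; have [M [x [y dxy]]] := real_ex d.
have [d' dGxy] : Etriangle (fmor G x) (fmor G y) by apply: GE; exists d.
have [w wE] := (pull_eq0 dGxy (unit_adj adj X)).1 (van _).
rewrite -[d]pull_id; apply/(pull_eq0 dxy).
exists (counit_adj adj M ∘ fmor F w).
by rewrite comp_assoc counit_nat -comp_assoc -fmor_comp wE triangle_l.
Qed.

(** Dually, the counit at [Y] extends along [F x], and the transpose of the extension is a
    retraction of [x]. *)
Lemma ext_vanish_adj_right (X : K) (Y : L) : ext_vanish (F X) Y -> ext_vanish X (G Y).
Proof.
move=> van d; have [M [x [y dxy]]] := real_ex d.
have [d' dFxy] : Etriangle (fmor F x) (fmor F y) by apply: FE; exists d.
have [w wE] := (push_eq0 dFxy (counit_adj adj Y)).1 (van _).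
rewrite -[d]push_id; apply/(push_eq0 dxy).
exists (fmor G w ∘ unit_adj adj M).
by rewrite -comp_assoc unit_nat comp_assoc -fmor_comp wE triangle_r.
Qed.

Lemma injective_right_adj (I : L) : injective_ob I -> injective_ob (G I).
Proof.
move=> injI X Y Z x y xy p.
have [q qE] := injI _ _ _ _ _ (FE xy) (counit_adj adj I ∘ fmor F p).
exists (fmor G q ∘ unit_adj adj Y).
rewrite -comp_assoc unit_nat comp_assoc -fmor_comp qE fmor_comp -comp_assoc -unit_nat.
by rewrite comp_assoc triangle_r comp_idl.
Qed.

Lemma nth_cosyzygy_right_adj k (Y Y' : L) :
  nth_cosyzygy k Y Y' -> nth_cosyzygy k (G Y) (G Y').
Proof.
elim=> {k Y Y'} [Y|k Y Y' Y'' _ IH [I [x [y [injI xy]]]]]; first by constructor.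
apply: (nth_cosyzygyS IH); exists (G I), (fmor G x), (fmor G y).
by split; [apply: injective_right_adj | apply: GE].
Qed.

(** [G] preserves injectives and triangles, so it carries a [k]-th cosyzygy of [Y] to one of [G Y].
    This reduces the claim to first extensions, up to the choice of cosyzygies. *)
Lemma extS_zero_adj (enP : enough_projectives K) (enIK : enough_injectives K)
    (enIL : enough_injectives L) k (X : K) (Y : L) :
  extS_zero enIL k (F X) Y <-> extS_zero enIK k X (G Y).
Proof.
have sG := nth_cosyzygy_right_adj (nth_cosyzygy_iter enIL k Y).
split=> [/ext_vanish_adj_right van|]; first exact/(extS_zero_cosyzygy _ enP _ sG).
by move=> /(extS_zero_cosyzygy _ enP _ sG) /ext_vanish_adj_left.
Qed.

End ExactAdjunction.

(** * Transfer of cotorsion pairs along a functor *)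

Section Transfer.
Variables (K L : extriCat) (enIK : enough_injectives K) (enIL : enough_injectives L).
Variables (G : addFunctor K L) (S1 S2 : addFunctor L K).
Hypothesis GE : preserves_Etriangles G.
Hypotheses (GS1 : forall Z, isomorphic (G (S1 Z)) Z)
  (GS2 : forall Z, isomorphic (G (S2 Z)) Z).
Variables (n : nat) (T F : set K) (T' F' : set L).
Hypotheses (T'E : forall Z, T' Z <-> T (S1 Z)) (F'E : forall Z, F' Z <-> F (S2 Z)).
Hypotheses (GT : forall X, T X -> T' (G X)) (GF : forall X, F X -> F' (G X)).
Hypothesis van : forall k, (k < n)%N -> extS_vanish enIL k T' F'.

(** Common pattern of both cases: [G] is [i^*] with [S1 = S2 = i_*], or [j^*] with [S1 = j_!] and
    [S2 = j_*]. The descriptions by [S1] and [S2] give closure under summands, and [G] transports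
    approximations. *)
Lemma cotorsion_pair_transfer : cotorsion_pair enIK n T F -> cotorsion_pair enIL n T' F'.
Proof.
move=> [[sumT _ apprT] [sumF _ apprF]]; split; split=> //.
- move=> X Y S /T'E TS; apply/T'E; have [S' eS] := fob_biprod S1 S.
  by apply: (sumT _ _ S'); rewrite eS.
- move=> Z; have [M [X0 [u [v [uv TX0 [m mn resM]]]]]] := apprT (S1 Z).
  (* The image triangle ends in [G (S1 Z)], so its last map is corrected by [c]. *)
  have [c ci] := GS1 Z.
  exists (G M), (G X0), (fmor G u ∘ idm _), (c ∘ fmor G v); split.
  + exact: Etriangle_iso_ends (GE uv) (is_iso_id _) ci.
  + exact: GT.
  + by exists m => //; apply: has_resolution_fob resM.
- move=> X Y S /F'E FS; apply/F'E; have [S' eS] := fob_biprod S2 S.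
  by apply: (sumF _ _ S'); rewrite eS.
- move=> Z; have [Y0 [M [u [v [uv FY0 [m mn resM]]]]]] := apprF (S2 Z).
  have [a ai] := isomorphic_sym (GS2 Z).
  exists (G Y0), (G M), (fmor G u ∘ a), (idm _ ∘ fmor G v); split.
  + exact: Etriangle_iso_ends (GE uv) ai (is_iso_id _).
  + exact: GF.
  + by exists m => //; apply: has_coresolution_fob resM.
Qed.

End Transfer.

(** * Functors of a recollement and the induced pairs *)

Section Recollement.
Variables (A B C : extriCat) (R : recollement A B C).
Local Notation iu := (i_upper_star R).
Local Notation il := (i_lower_star R).
Local Notation ish := (i_upper_shriek R).
Local Notation jsh := (j_lower_shriek R).
Local Notation ju := (j_upper_star R).
Local Notation jl := (j_lower_star R).

Let il_E := exact_preserves_Etriangles (i_lower_star_exact R).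
Let ju_E := exact_preserves_Etriangles (j_upper_star_exact R).

Lemma i_upper_star_lower_star (Z : A) : isomorphic (iu (il Z)) Z.
Proof. by eexists; apply: (counit_iso_of_ff (adj_i_star R) (i_lower_star_ff R)). Qed.

Lemma i_upper_shriek_lower_star (Z : A) : isomorphic (ish (il Z)) Z.
Proof.
apply: isomorphic_sym; eexists.
exact: (unit_iso_of_ff (adj_i_shriek R) (i_lower_star_ff R)).
Qed.

Lemma j_upper_star_lower_star (W : C) : isomorphic (ju (jl W)) W.
Proof. by eexists; apply: (counit_iso_of_ff (adj_j_star R) (j_lower_star_ff R)). Qed.

Lemma j_upper_star_lower_shriek (W : C) : isomorphic (ju (jsh W)) W.
Proof.
apply: isomorphic_sym; eexists.
exact: (unit_iso_of_ff (adj_j_shriek R) (j_lower_shriek_ff R)).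
Qed.

Lemma j_upper_star_i_lower_star (Z : A) : is_zero (ju (il Z)).
Proof. by apply/im_i_ker_j; exists Z; apply: isomorphic_refl. Qed.

(** Transposing twice turns the identity into a map from [W] to an object of the form [j^* i_* Z],
    which is zero. *)
Lemma i_upper_star_j_lower_shriek (W : C) : is_zero (iu (jsh W)).
Proof.
apply/is_zeroP; apply: (hom_left_adj0 (adj_i_star R)).
apply: (hom_left_adj0 (adj_j_shriek R)).
exact: (j_upper_star_i_lower_star _).2.
Qed.

Lemma i_upper_shriek_j_lower_star (W : C) : is_zero (ish (jl W)).
Proof.
apply/is_zeroP; apply: (hom_right_adj0 (adj_i_shriek R)).
apply: (hom_right_adj0 (adj_j_star R)).
exact: (j_upper_star_i_lower_star _).1.
Qed.

(** An object killed by [j^*] has the form [i_* Z], and [Z] is recovered as [i^* X]. *)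
Lemma zero_of_i_upper_star (X : B) : is_zero (ju X) -> is_zero (iu X) -> is_zero X.
Proof.
move=> /im_i_ker_j [Z ZX] iX; apply: (isomorphic_zero ZX); apply: is_zero_fob.
apply: (isomorphic_zero (i_upper_star_lower_star Z)).
exact: isomorphic_zero (isomorphic_sym (isomorphic_fob iu ZX)) iX.
Qed.

Lemma zero_of_i_upper_shriek (X : B) : is_zero (ju X) -> is_zero (ish X) -> is_zero X.
Proof.
move=> /im_i_ker_j [Z ZX] iX; apply: (isomorphic_zero ZX); apply: is_zero_fob.
apply: (isomorphic_zero (i_upper_shriek_lower_star Z)).
exact: isomorphic_zero (isomorphic_sym (isomorphic_fob ish ZX)) iX.
Qed.

Hypothesis wicC : WIC C.

(* Left exactness gives an inflation [h] with target [j_* Z] comparing the cone of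
   [j_* x] with [j_* Z]; both [j^*] and [i^!] kill the cone of [h]. *)
Lemma j_lower_star_preserves_Etriangles :
  preserves_Etriangles ish -> preserves_Etriangles jl.
Proof.
move=> ishE X Y Z x y xy.
have [_ /(_ _ _ _ _ _ (Etriangle_left_exact xy))] := j_lower_star_left_exact R.
move=> [M [h1 [h2 [xh1 [Q [q h2q]] h2c yE]]]].
have juxy : Etriangle (fmor ju (fmor jl x)) (fmor ju (fmor jl y)).
  have ci := counit_iso_of_ff (adj_j_star R) (j_lower_star_ff R).
  by apply: (Etriangle_iso_inv xy (ci X) (ci Y) (ci Z)); rewrite counit_nat.
have juh2 : is_iso (fmor ju h2).
  (* [j^*] keeps [h2] compatible, so it remains to see an inflation and a deflation. The latter
     comes from WIC, as [j^* h2] is the last factor of the deflation [j^* j_* y]. *)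
  apply: (j_upper_star_exact R).1 => //.
    by apply: (inflation_fmor ju_E); exists Q, q.
  apply: (wicC.2 _ _ _ (fmor ju h1)); rewrite -fmor_comp -yE.
  by exists (ju (jl X)), (fmor ju (fmor jl x)).
have ishM : is_zero (ish M).
  by apply: cone_zero (ishE _ _ _ _ _ xh1) _ _; apply: i_upper_shriek_j_lower_star.
have Q0 : is_zero Q.
  apply: zero_of_i_upper_shriek; first exact: cone_zero_of_iso (ju_E h2q) juh2.
  exact: cone_zero (ishE _ _ _ _ _ h2q) ishM (i_upper_shriek_j_lower_star _).
rewrite yE -[fmor jl x]comp_idr.
exact: Etriangle_iso_ends xh1 (is_iso_id _) (iso_of_cone_zero h2q Q0).
Qed.

(** Dual argument: right exactness gives a deflation [h1] from [j_! X] to the cocone of [j_! y], and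
    [j^*] and [i^*] both kill the cocone of [h1]. *)
Lemma j_lower_shriek_preserves_Etriangles :
  preserves_Etriangles iu -> preserves_Etriangles jsh.
Proof.
move=> iuE X Y Z x y xy.
have [_ /(_ _ _ _ _ _ (Etriangle_right_exact xy))] := j_lower_shriek_right_exact R.
move=> [M [h2 [h1 [h2y [Q [q qh1]] h1c xE]]]].
have juxy : Etriangle (fmor ju (fmor jsh x)) (fmor ju (fmor jsh y)).
  have ui := unit_iso_of_ff (adj_j_shriek R) (j_lower_shriek_ff R).
  by apply: (Etriangle_iso xy (ui X) (ui Y) (ui Z)); rewrite unit_nat.
have juh1 : is_iso (fmor ju h1).
  apply: (j_upper_star_exact R).1 => //; last first.
    by apply: (deflation_fmor ju_E); exists Q, q.
  apply: (wicC.1 _ _ _ _ (fmor ju h2)); rewrite -fmor_comp -xE.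
  by exists (ju (jsh Z)), (fmor ju (fmor jsh y)).
have iuM : is_zero (iu M).
  by apply: cocone_zero (iuE _ _ _ _ _ h2y) _ _; apply: i_upper_star_j_lower_shriek.
have Q0 : is_zero Q.
  apply: zero_of_i_upper_star; first exact: cocone_zero_of_iso (ju_E qh1) juh1.
  exact: cocone_zero (iuE _ _ _ _ _ qh1) (i_upper_star_j_lower_shriek _) iuM.
rewrite xE -[fmor jsh y]comp_idl.
exact: Etriangle_iso_ends h2y (iso_of_cocone_zero qh1 Q0) (is_iso_id _).
Qed.

Hypotheses (enPA : enough_projectives A) (enIA : enough_injectives A)
  (enPB : enough_projectives B) (enIB : enough_injectives B)
  (enPC : enough_projectives C) (enIC : enough_injectives C).
Hypotheses (iuE : preserves_Etriangles iu) (ishE : preserves_Etriangles ish).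
Variables T F : set B.
Hypothesis iiT : image_class il (image_class iu T) `<=` T.

Let jlE := j_lower_star_preserves_Etriangles ishE.
Let jshE := j_lower_shriek_preserves_Etriangles iuE.

(** E^{k+1}(Z, i^! Y) vanishes along with E^{k+1}(i_* Z, Y), and [i_* Z] lies in [T] by [iiT]. *)
Lemma extS_vanish_i k :
  extS_vanish enIB k T F -> extS_vanish enIA k (image_class iu T) (image_class ish F).
Proof.
move=> van Z Z' TZ [Y FY YZ']; apply: (extS_zero_isor enPA YZ').
apply/(extS_zero_adj (adj_i_shriek R) il_E ishE enPA enIA enIB).
by move=> d; apply: van => //; apply: iiT; apply: image_class_fob.
Qed.

Hypothesis jjF : image_class jl (image_class ju F) `<=` F.

(** Here [j^* X] is traded for [j_* W'], which [jjF] places in [F]. *)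
Lemma extS_vanish_j k :
  extS_vanish enIB k T F -> extS_vanish enIC k (image_class ju T) (image_class ju F).
Proof.
move=> van W W' [X TX XW] FW'; apply: (extS_zero_isol XW).
apply/(extS_zero_adj (adj_j_star R) ju_E jlE enPB enIB enIC).
by move=> d; apply: van => //; apply: jjF; apply: image_class_fob.
Qed.

Hypotheses (isoT : iso_closed T) (isoF : iso_closed F).
Variable n : nat.
Hypotheses (n_ge1 : (1 <= n)%N) (TF : cotorsion_pair enIB n T F).

Let TF0 k : (k < n)%N -> extS_vanish enIB k T F.
Proof. by case: TF => -[_ van _] _; apply: van. Qed.

Lemma image_i_upper_starE (Z : A) : image_class iu T Z <-> T (il Z).
Proof.
split=> TZ; first by apply: iiT; apply: image_class_fob.
by exists (il Z) => //; apply: i_upper_star_lower_star.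
Qed.

(** By orthogonality, [i_* Z] lies in [F] once E^{k+1}(X, i_* Z) = 0 for [X] in [T]; this reduces to
    E^{k+1}(i^* X, Z) = 0, already known in [A]. *)
Lemma image_i_upper_shriekE (Z : A) : image_class ish F Z <-> F (il Z).
Proof.
split=> FZ; last by exists (il Z) => //; apply: i_upper_shriek_lower_star.
apply: (right_cotorsion_pair_perp n_ge1 isoF TF.2) => k X kn TX.
apply/(extS_zero_adj (adj_i_star R) iuE il_E enPB enIB enIA).
by move=> d; apply: (extS_vanish_i (TF0 kn)) FZ _; apply: image_class_fob.
Qed.

Lemma image_j_upper_star_starE (W : C) : image_class ju F W <-> F (jl W).
Proof.
split=> FW; first by apply: jjF; apply: image_class_fob.
by exists (jl W) => //; apply: j_upper_star_lower_star.
Qed.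

(** The same argument on the other side of the pair, through the adjunction of [j_!] and [j^*]. *)
Lemma image_j_upper_star_shriekE (W : C) : image_class ju T W <-> T (jsh W).
Proof.
split=> TW; last by exists (jsh W) => //; apply: j_upper_star_lower_shriek.
apply: (left_cotorsion_pair_perp enPB n_ge1 isoT TF.1) => k Y kn FY.
apply/(extS_zero_adj (adj_j_shriek R) jshE ju_E enPC enIC enIB).
by move=> d; apply: (extS_vanish_j (TF0 kn)) TW _ _; apply: image_class_fob.
Qed.

Hypothesis iiF : image_class il (image_class iu F) `<=` F.

Lemma cotorsion_pair_i : cotorsion_pair enIA n (image_class iu T) (image_class ish F).
Proof.
apply: (cotorsion_pair_transfer iuE i_upper_star_lower_star i_upper_star_lower_star
  image_i_upper_starE image_i_upper_shriekE _ _ _ TF).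
- by move=> X TX; apply: image_class_fob.
- move=> Y FY; apply/image_i_upper_shriekE; apply: iiF; apply: image_class_fob.
  exact: image_class_fob.
- by move=> k kn; apply: extS_vanish_i; apply: TF0.
Qed.

Lemma cotorsion_pair_j : cotorsion_pair enIC n (image_class ju T) (image_class ju F).
Proof.
apply: (cotorsion_pair_transfer ju_E j_upper_star_lower_shriek j_upper_star_lower_star
  image_j_upper_star_shriekE image_j_upper_star_starE _ _ _ TF).
- by move=> X TX; apply: image_class_fob.
- by move=> Y FY; apply: image_class_fob.
- by move=> k kn; apply: extS_vanish_j; apply: TF0.
Qed.

End Recollement.

Theorem theorem3p9 (n : nat) (n_ge1 : (1 <= n)%N)
  (A B C : extriCat)
  (wicA : WIC A) (wicB : WIC B) (wicC : WIC C)
  (enPA : enough_projectives A) (enIA : enough_injectives A)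
  (enPB : enough_projectives B) (enIB : enough_injectives B)
  (enPC : enough_projectives C) (enIC : enough_injectives C)
  (R : recollement A B C)
  (T F : set B) (isoT : iso_closed T) (isoF : iso_closed F)
  (TF : cotorsion_pair enIB n T F)
  (exact_i_star : exact_functor (i_upper_star R))
  (exact_i_shriek : exact_functor (i_upper_shriek R))
  (jjF : image_class (j_lower_star R) (image_class (j_upper_star R) F) `<=` F)
  (iiT : image_class (i_lower_star R) (image_class (i_upper_star R) T) `<=` T)
  (iiF : image_class (i_lower_star R) (image_class (i_upper_star R) F) `<=` F) :
  [/\ cotorsion_pair enIA n
        (image_class (i_upper_star R) T) (image_class (i_upper_shriek R) F),
      cotorsion_pair enIC n
        (image_class (j_upper_star R) T) (image_class (j_upper_star R) F)
    & hereditary_cotorsion_pair enIB n T F ->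
      hereditary_cotorsion_pair enIA n
        (image_class (i_upper_star R) T) (image_class (i_upper_shriek R) F) /\
      hereditary_cotorsion_pair enIC n
        (image_class (j_upper_star R) T) (image_class (j_upper_star R) F)].
Proof.
have iuE := exact_preserves_Etriangles exact_i_star.
have ishE := exact_preserves_Etriangles exact_i_shriek.
have cotA := cotorsion_pair_i enPA enIA enPB iuE ishE iiT isoF n_ge1 TF iiF.
have cotC := cotorsion_pair_j wicC enPB enPC enIC iuE ishE jjF isoT n_ge1 TF.
(* The hereditary condition is the case [k = n] of the vanishing lemmas, which hold for every
   [k]. *)
split=> // -[_ van]; split; split=> //; first exact: extS_vanish_i van.
exact: extS_vanish_j van.
Qed.
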